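(* Let $n\ge 1$ and $m$ be integers with $t_2(n)+1\le m\le t_3(n)$. Then $f(n,m)=g_2(n,m)-3$.
   Context: All graphs are finite and simple. A graph is chordal if it contains no induced cycle of length at least $4$. Subgraphs are not required to be induced. For integers $n\ge 1$ and $0\le m\le \binom n2$, $f(n,m)$ denotes the maximum integer such that every graph with $n$ vertices and $m$ edges contains a chordal subgraph with at least $f(n,m)$ edges. $T_k(n)$ is the Turán graph, i.e. the complete $k$-partite graph on $n$ vertices with part sizes as equal as possible, and $t_k(n)$ is its number of edges; in particular $t_2(r)=\lfloor r^2/4\rfloor$. For integers $n\ge 1$ and $m\ge t_2(n)+1$, $g_2(n,m)$ is the minimum of $2n-t+r$ over all pairs of integers $t,r\ge 0$ satisfying $t(n-t)+t_2(r)\ge m$. *)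

(* Defs.v *)
From HB Require Import structures.
From mathcomp Require Import all_boot all_order all_algebra.

Set Implicit Arguments.
Unset Strict Implicit.
Unset Printing Implicit Defensive.

Import Order.TTheory GRing.Theory Num.Theory.

(* T is only an ambient type: the vertex set may be a proper subset of it, so
   that a subgraph may have fewer vertices. *)
Record graph (T : finType) := Graph {
  vertices : {set T};
  edges : {set {set T}};
  edge_valid : forall A, A \in edges -> (A \subset vertices) && (#|A| == 2)
}.

Definition adj (T : finType) (G : graph T) : rel T :=
  fun x y => [set x; y] \in edges G.

Definition subgraph (T : finType) (H G : graph T) : bool :=
  (vertices H \subset vertices G) && (edges H \subset edges G).

(* [next c x] is the cyclic successor of x in c. The last clause says both
   that c is a cycle of G and that it has no chord. *)
Definition induced_cycle (T : finType) (G : graph T) (c : seq T) : Prop :=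
  [/\ 3 <= size c, uniq c, {subset c <= vertices G} &
      {in c &, forall x y, adj G x y = (y == next c x) || (x == next c y)}].

Definition chordal (T : finType) (G : graph T) : Prop :=
  forall c : seq T, induced_cycle G c -> ~~ (4 <= size c).

(* The parts are the residue classes mod k, whose sizes differ by at most 1. *)
Definition turan_edges (k n : nat) : {set {set 'I_n}} :=
  [set [set p.1; p.2] | p : 'I_n * 'I_n & p.1 %% k != p.2 %% k].

Lemma turan_edge_valid (k n : nat) (A : {set 'I_n}) :
  A \in turan_edges k n -> (A \subset [set: 'I_n]) && (#|A| == 2).
Proof.
case/imsetP=> -[i j] /=; rewrite inE /= => ij ->.
rewrite subsetT cards2; suff -> : i != j by [].
by apply: contraNneq ij => ->.
Qed.

Definition turan_graph (k n : nat) : graph 'I_n :=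
  Graph (@turan_edge_valid k n).

Definition turan_number (k n : nat) : nat := #|edges (turan_graph k n)|.

Local Open Scope ring_scope.

Definition is_maximum (P : int -> Prop) (v : int) : Prop :=
  P v /\ forall w, P w -> w <= v.

Definition is_minimum (P : int -> Prop) (v : int) : Prop :=
  P v /\ forall w, P w -> v <= w.

Definition chordal_guarantee (n m : nat) (k : int) : Prop :=
  forall (T : finType) (G : graph T),
    #|vertices G| = n -> #|edges G| = m ->
    exists H : graph T, [/\ subgraph H G, chordal H & k <= #|edges H|%:Z].

(* [is_f n m v] means f(n,m) = v, and [is_g2 n m v] means g_2(n,m) = v. *)
Definition is_f (n m : nat) : int -> Prop :=
  is_maximum (chordal_guarantee n m).

(* Since t may exceed n, both t(n-t) and 2n-t+r are computed in int, where
   subtraction is not truncated. *)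
Definition is_g2 (n m : nat) : int -> Prop :=
  is_minimum (fun v => exists t r : nat,
    m%:Z <= t%:Z * (n%:Z - t%:Z) + (turan_number 2 r)%:Z /\
    v = 2 * n%:Z - t%:Z + r%:Z).

(* Main.v *)
Require Import Defs.
From mathcomp Require Import all_boot all_order all_algebra.
From mathcomp Require Import zify.

Set Implicit Arguments.
Unset Strict Implicit.
Unset Printing Implicit Defensive.

Import GRing.Theory Num.Theory.

(* Upper bound.  Let (t, r) be an optimal pair; then r <= t < n.  Split the
   n vertices into A and B with #|A| = t, choose C1 and C2 in A of sizes r/2 and
   r - r/2, and join A to B and C1 to C2 completely.  A triangle-free vertex
   set X spans a forest in a chordal graph, hence at most #|X| - 1 edges; applied
   to B + (A - C2), B + C2 and C1 + C2, which cover all edges, this bounds a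
   chordal subgraph by 2n - t + r - 3 edges.

   Lower bound.  Let v have maximum degree D, let o = n - D, let x maximise the
   degree in N(v), and y the degree in N(v) and N(x).  Attach every other vertex
   to its neighbours in the triangle vxy.  A vertex with exactly one neighbour t
   there gets a second edge to an earlier vertex of N(t), except for one vertex
   in each component of G[N(t)] that misses the triangle; a vertex without
   neighbours in the triangle gets one edge, except for one vertex in each
   component of G.  The result is chordal.  The exceptional vertices have small
   degree, because their neighbourhoods avoid N(t) outside their component, so
   they lower the number of edges of G.  If the chordal graph has at most
   2n - D + r - 3 edges, where r <= D, this trade-off gives
   m <= D (n - D) + r^2 / 4; hence (D, r) is a valid pair for g_2(n,m). *)

(** * Chordal graphs built vertex by vertex *)

Lemma disjoint_setU1 (T : finType) (w : T) (A B : {set T}) :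
  [disjoint A & B] -> w \notin A -> [disjoint A & w |: B].
Proof.
move=> dAB wA; rewrite disjoint_subset; apply/subsetP => z zA.
rewrite !inE negb_or (disjointFr dAB zA) andbT.
by apply: contraNneq wA => <-.
Qed.

Section Build.
Variables (T : finType) (G : graph T).
Implicit Types (S B C R P Q K : {set T}) (F : {set {set T}}) (u v w : T).

Definition nbr u : {set T} := [set w | adj G u w].

Definition linked F Q := {in Q &, forall a b, a != b -> [set a; b] \in F}.

(** A perfect elimination order read backwards. The clique condition on [Q] refers to [F], not to
    [G], since the chordal subgraph need not be induced. *)
Inductive build : {set T} -> {set {set T}} -> Prop :=
| build0 : build set0 set0
| buildS S F u Q : build S F -> u \in vertices G -> u \notin S ->
    Q \subset S -> Q \subset nbr u -> linked F Q ->
    build (u |: S) (F :|: [set [set u; q] | q in Q]).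

Lemma adjC u w : adj G u w = adj G w u.
Proof. by rewrite /adj setUC. Qed.

Lemma adj_irr u : adj G u u = false.
Proof.
apply/negP => /edge_valid /andP[_]; by rewrite setUid cards1.
Qed.

Lemma adj_vertex u w : adj G u w -> u \in vertices G.
Proof. by move=> /edge_valid /andP[/subsetP s _]; apply: s; rewrite set21. Qed.

Lemma nbr_sub u : nbr u \subset vertices G.
Proof. by apply/subsetP => w; rewrite inE adjC => /adj_vertex. Qed.

Lemma build_sub S F e : build S F -> e \in F -> e \subset S.
Proof.
elim=> {S F} [|S F u Q _ IH _ _ QS _ _]; first by rewrite inE.
rewrite inE => /orP[/IH|]; first by move=> /subset_trans-> //; apply: subsetUr.
case/imsetP => q qQ ->; rewrite subUset !sub1set setU11 /= inE.
by rewrite (subsetP QS) ?orbT.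
Qed.

Lemma build_edges S F : build S F -> F \subset edges G.
Proof.
elim=> {S F} [|S F u Q _ IH _ _ _ Qu _]; first exact: sub0set.
rewrite subUset IH /=; apply/subsetP => _ /imsetP[q qQ ->].
by move/subsetP: Qu => /(_ _ qQ); rewrite inE.
Qed.

Lemma set2_inj u : injective (fun q : T => [set u; q]).
Proof.
move=> q q' /= /setP E; move: (E q) (E q'); rewrite !inE !eqxx !orbT.
case: (eqVneq q u) => [->|_] /=; last by move=> /esym/eqP.
by rewrite eq_sym => _; case: (eqVneq u q') => //= _ /esym; rewrite orbb.
Qed.

Lemma card_build_step S F u Q : build S F -> u \notin S ->
  #|F :|: [set [set u; q] | q in Q]| = #|F| + #|Q|.
Proof.
move=> b uS; rewrite cardsU (_ : _ :&: _ = set0) ?cards0 ?subn0.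
  by rewrite card_imset //; apply: set2_inj.
apply/setP => e; rewrite !inE; apply/negbTE/negP => /andP[eF /imsetP[q _ E]].
by move/negP: uS; apply; apply: (subsetP (build_sub b eF)); rewrite E set21.
Qed.

Lemma build_edge_valid S F : build S F ->
  forall e, e \in F -> (e \subset vertices G) && (#|e| == 2).
Proof. by move=> b e eF; apply: edge_valid; apply: (subsetP (build_edges b)). Qed.

(* In an induced cycle of length at least 4 the vertex that was attached last
   has two non-adjacent earlier neighbours, but these lie in a clique. *)
Lemma build_chordal S F : build S F -> forall c : seq T, 4 <= size c -> uniq c ->
  ~ {in c &, forall x y, ([set x; y] \in F) = (y == next c x) || (x == next c y)}.
Proof.
elim=> {S F} [|S F u Q bS IH uV uS QS Qu lQ] c c4 Uc Hc.
  case: c c4 Uc Hc => [|a [|b c]] //= _ _ /(_ a b).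
  by rewrite !inE !eqxx !orbT => /(_ isT isT).
case: (boolP (u \in c)) => [uc|uc]; last first.
  apply: (IH c c4 Uc) => x y xc yc; rewrite -Hc // inE.
  case E: (_ \in imset _ _); rewrite ?orbF //.
  case/imsetP: E => q _ /setP/(_ u); rewrite !inE eqxx /=.
  by case/orP=> /eqP e; case/negP: uc; rewrite e.
(* Rotated to start at [u], the cycle is [u, a, b, ..., z]; the neighbours [a] and [z] of [u] lie in
   the clique [Q], yet they are not consecutive. *)
have [i p E] := rot_to uc.
have {uc}Hp : {in u :: p &, forall x y, ([set x; y] \in F :|: [set [set u; q] | q in Q])
    = (y == next (u :: p) x) || (x == next (u :: p) y)}.
  by move=> x y; rewrite -E !mem_rot !next_rot //; apply: Hc.
have Up : uniq (u :: p) by rewrite -E rot_uniq.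
have : 4 <= size (u :: p) by rewrite -E size_rot.
case/lastP: p {E} Hp Up => // p z; case: p => [|a p] // Hp Up sz.
case: p Hp Up sz => [|b p] // Hp Up _.
have nQ q : [set u; q] \in F :|: [set [set u; q] | q in Q] -> q \in Q.
  rewrite inE => /orP[/(build_sub bS)|].
    by rewrite subUset sub1set (negbTE uS).
  by case/imsetP => q' qQ /set2_inj ->.
have aQ : a \in Q.
  have ain : a \in [:: u, a, b & rcons p z] by rewrite !inE eqxx orbT.
  by apply: nQ => //; rewrite Hp ?mem_head //= eqxx eqxx.
have zin : z \in [:: u, a, b & rcons p z] by rewrite !inE mem_rcons mem_head !orbT.
(* [z] is last, so [next_nth] reads past the tail and returns its default, the head [u]. *)
have nz : next [:: u, a, b & rcons p z] z = u.
  have zp : z \notin [:: u, a, b & p].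
    by move: Up; rewrite -!rcons_cons rcons_uniq => /andP[].
  have iz : index z [:: u, a, b & rcons p z] = (size p).+3.
    rewrite -!rcons_cons -cats1 index_cat (negbTE zp) /= eqxx; exact: addn0.
  by rewrite next_nth zin iz nth_default //= size_rcons.
have zQ : z \in Q.
  by apply: nQ => //; rewrite Hp ?mem_head // nz eqxx orbT.
have az : a != z.
  by move: Up => /= /and3P[_ + _]; apply: contraNneq => ->; rewrite inE mem_rcons mem_head orbT.
have : [set a; z] \in F :|: [set [set u; q] | q in Q].
  by rewrite inE lQ.
rewrite Hp // ?inE ?eqxx ?orbT // nz.
have au : a != u by move: Up => /= /andP[+ _]; apply: contraNneq => ->; rewrite mem_head.
rewrite (negbTE au) orbF /= eq_sym (negbTE au) eqxx => /eqP zb.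
by move: Up => /= /and4P[_ _ + _]; rewrite zb mem_rcons mem_head.
Qed.

Lemma build_chordal_subgraph S F : build S F ->
  exists H : graph T, [/\ subgraph H G, chordal H & edges H = F].
Proof.
move=> b; exists (Graph (build_edge_valid b)); split=> //.
  by rewrite /subgraph subxx (build_edges b).
move=> c [_ Uc _ Hc]; apply/negP => c4.
exact: (build_chordal b c4 Uc).
Qed.

Lemma buildW S F u Q : build S F -> u \in vertices G -> u \notin S ->
    Q \subset S -> Q \subset nbr u -> linked F Q ->
  exists2 F', build (u |: S) F' &
    [/\ F \subset F', #|F'| = #|F| + #|Q| & {in Q, forall q, [set u; q] \in F'}].
Proof.
move=> b uV uS QS Qu lQ; exists (F :|: [set [set u; q] | q in Q]).
  exact: buildS.
split; [exact: subsetUl | exact: card_build_step b uS |].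
by move=> q qQ; rewrite inE; apply/orP; right; apply/imsetP; exists q.
Qed.

Lemma linkedW F F' Q : F \subset F' -> linked F Q -> linked F' Q.
Proof. by move=> /subsetP s l a b aQ bQ ab; apply/s/l. Qed.

(** The clique [C] consists of old vertices and stays a clique, so [P] can be attached in any
    order. *)
Lemma attach_all C S F P : build S F -> C \subset S -> linked F C ->
    P \subset vertices G -> [disjoint P & S] ->
  exists2 F', build (S :|: P) F' &
    [/\ F \subset F', #|F'| = #|F| + \sum_(u in P) #|nbr u :&: C| &
        forall u c, u \in P -> c \in nbr u :&: C -> [set u; c] \in F'].
Proof.
move=> bS CS lC; move: {2}#|P| (erefl #|P|) => k.
elim: k P => [|k IH] P.
  move=> /eqP; rewrite cards_eq0 => /eqP-> _ _; exists F; first by rewrite setU0.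
  by split=> //; [rewrite big_set0 addn0 | move=> u c; rewrite inE].
move=> cP PV dP; have /set0Pn[u uP] : P != set0 by rewrite -cards_eq0 cP.
have [F1 b1 [F01 c1 h1]] : exists2 F', build (S :|: P :\ u) F' &
    [/\ F \subset F', #|F'| = #|F| + \sum_(w in P :\ u) #|nbr w :&: C| &
        forall w c, w \in P :\ u -> c \in nbr w :&: C -> [set w; c] \in F'].
  apply: IH; first by have := cardsD1 u P; rewrite uP cP => -[].
    exact: subset_trans (subD1set _ _) PV.
  exact: disjointWl (subD1set _ _) dP.
have uS : u \notin S by rewrite (disjointFr dP).
have [F2 b2 [F12 c2 h2]] : exists2 F', build (u |: (S :|: P :\ u)) F' &
    [/\ F1 \subset F', #|F'| = #|F1| + #|nbr u :&: C| &
      {in nbr u :&: C, forall q, [set u; q] \in F'}].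
  apply: buildW => //; first exact: (subsetP PV).
  - by rewrite !inE negb_or uS eqxx.
  - by rewrite subIset // (subset_trans CS) ?orbT // subsetUl.
  - exact: subsetIl.
  - by move=> a b /setIP[_ aC] /setIP[_ bC]; apply: (linkedW F01 lC).
exists F2; first by rewrite -(setD1K uP) setUCA.
split; first exact: subset_trans F01 F12.
  by rewrite c2 c1 [in RHS](big_setD1 u) //=; lia.
move=> w c wP cw; case: (eqVneq w u) => [wu|wu]; first by rewrite wu h2 // -wu.
by apply/(subsetP F12)/h1; rewrite // !inE wu.
Qed.

(* [ready B R S F]: a new vertex of [R] may be attached to the clique [p |: B],
   for any [p] in [R] that was attached before. *)
Definition ready B R S F :=
  [/\ build S F, B \subset S, linked F B &
      forall p b, p \in S :&: R -> b \in B -> [set p; b] \in F].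

(** Because [B \subset Q], the new vertex is joined to all of [B] and can in turn serve as a [p] in
    [ready]. *)
Lemma attach B R S F w Q : ready B R S F -> w \in R -> w \in vertices G ->
    w \notin S -> {in R, forall p, B \subset nbr p} ->
    B \subset Q -> Q \subset S -> Q \subset nbr w -> linked F Q ->
  exists2 F', ready B R (w |: S) F' & F \subset F' /\ #|F'| = #|F| + #|Q|.
Proof.
move=> [b BS lB rB] wR wV wS RB BQ QS Qw lQ.
have [F' b' [FF' c h]] := buildW b wV wS QS Qw lQ.
exists F' => //; split=> //; first exact: subset_trans BS (subsetUr _ _).
  exact: linkedW FF' lB.
move=> p q; rewrite !inE => /andP[/orP[/eqP->|pS] pR] qB.
  by apply/h/(subsetP BQ).
by apply/(subsetP FF')/rB; rewrite // inE pS.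
Qed.

Lemma linked_insert B R S F p : ready B R S F -> p \in S :&: R ->
  linked F (p |: B).
Proof.
move=> [_ _ lB rB] pS a b; rewrite !inE.
case/orP=> [/eqP->|aB] /orP[/eqP->|bB]; first by rewrite eqxx.
- by move=> _; apply: rB.
- by move=> _; rewrite setUC; apply: rB.
- exact: lB.
Qed.

Lemma attach_edge B R S F w p : ready B R S F -> w \in R -> w \in vertices G ->
    w \notin S -> {in R, forall q, B \subset nbr q} ->
    p \in S :&: R -> adj G w p ->
  exists2 F', ready B R (w |: S) F' & F \subset F' /\ #|F'| = #|F| + #|B|.+1.
Proof.
move=> rd wR wV wS RB pS wp; have [pS' pR] := setIP pS.
have pB : p \notin B.
  by apply/negP => /(subsetP (RB _ pR)); rewrite inE adj_irr.
have [b BS lB rB] := rd.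
have [] := @attach B R S F w (p |: B) rd wR wV wS RB.
- exact: subsetUr.
- by rewrite subUset sub1set pS'.
- by rewrite subUset sub1set inE wp RB.
- exact: linked_insert rd pS.
by move=> F' rd' [s c]; exists F' => //; split=> //; rewrite c cardsU1 pB add1n.
Qed.

(** Greedy search: [Q] collects the vertices of [P] reached from [S :&: R], each attached to some
    [p |: B]; the last clause says that the search is exhausted. *)
Lemma grow B R S F P : ready B R S F -> P \subset R -> P \subset vertices G ->
    [disjoint P & S] -> {in R, forall q, B \subset nbr q} ->
  exists F' Q, [/\ ready B R (S :|: Q) F', F \subset F', Q \subset P,
     #|F'| = #|F| + #|B|.+1 * #|Q| &
     forall w p, w \in P :\: Q -> p \in (S :|: Q) :&: R -> ~~ adj G w p].
Proof.
move: {2}#|P| (leqnn #|P|) => k.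
elim: k P S F => [|k IH] P S F cP rd PR PV dP RB.
  exists F, set0; rewrite setU0 sub0set cards0 muln0 addn0; split=> // w p.
  by move: cP; rewrite leqn0 cards_eq0 => /eqP->; rewrite !inE andbF.
have [/existsP[w /existsP[p /and3P[wP pS wp]]]|no] :=
    boolP [exists w, exists p, [&& w \in P, p \in S :&: R & adj G w p]].
  have wS : w \notin S by rewrite (disjointFr dP).
  have [F1 rd1 [s1 c1]] := attach_edge rd (subsetP PR _ wP) (subsetP PV _ wP) wS RB pS wp.
  have [] := IH (P :\ w) (w |: S) F1.
  - by move: cP; rewrite (cardsD1 w) wP.
  - exact: rd1.
  - exact: subset_trans (subD1set _ _) PR.
  - exact: subset_trans (subD1set _ _) PV.
  - apply: disjoint_setU1; first exact: disjointWl (subD1set _ _) dP.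
    by rewrite !inE eqxx.
  - exact: RB.
  move=> F2 [Q [rd2 s2 QP c2 h2]]; exists F2, (w |: Q).
  have wQ : w \notin Q by apply/negP => /(subsetP QP); rewrite !inE eqxx.
  have e : S :|: (w |: Q) = w |: S :|: Q by rewrite setUCA setUA.
  rewrite e; split=> //; first exact: subset_trans s1 s2.
  - by rewrite subUset sub1set wP (subset_trans QP) // subD1set.
  - by rewrite c2 c1 cardsU1 wQ mulnDr muln1 addnA.
  - move=> z q zP; apply: h2; move: zP; rewrite !inE negb_or => /andP[/andP[-> ->] ->].
    by [].
exists F, set0; rewrite setU0 sub0set cards0 muln0 addn0; split=> // w p.
rewrite setD0 => wP pS; apply: contra no => wp.
by apply/existsP; exists w; apply/existsP; exists p; rewrite wP pS.
Qed.

(* [i] counts the components of [G[R]] inside [P] that are not joined to [S];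
   each of them costs one edge.  Such a component [K] with at most [H] vertices
   has total deficit [D] at least [H]; there are [b] larger ones. *)
Lemma attach_components B R S F P (D : T -> nat) (H : nat) :
    ready B R S F -> P \subset R -> R \subset S :|: P -> P \subset vertices G ->
    [disjoint P & S] -> {in R, forall q, B \subset nbr q} ->
    (forall K w, K \subset P -> w \in K -> nbr w :&: R \subset K ->
       H < D w + #|K|) ->
  exists F' i b, [/\ ready B R (S :|: P) F', F \subset F',
     #|B|.+1 * #|P| + #|F| <= #|F'| + i,
     i * H <= \sum_(w in P) D w + b * H & i + b * H <= #|P|].
Proof.
move: {2}#|P| (leqnn #|P|) => k.
elim: k P S F => [|k IH] P S F cP rd PR RS PV dP RB hK.
  exists F, 0, 0; move: cP; rewrite leqn0 cards_eq0 => /eqP->.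
  by rewrite setU0 cards0; split=> //; rewrite ?muln0 ?add0n ?addn0.
(* What [Q] leaves of [P] is a union of components of [G[R]]. *)
have [F1 [Q [rd1 s1 QP c1 h1]]] := grow rd PR PV dP RB.
have cPQ : #|P| = #|Q| + #|P :\: Q|.
  by rewrite -(cardsID Q P) (setIidPr QP).
have sumPQ (f : T -> nat) : \sum_(w in P) f w = \sum_(w in Q) f w + \sum_(w in P :\: Q) f w.
  by rewrite (big_setID Q) /= (setIidPr QP).
have [P0|/set0Pn[w wP]] := eqVneq (P :\: Q) set0.
  have -> : P = Q by apply/eqP; rewrite eqEsubset QP -setD_eq0 P0 eqxx.
  by exists F1, 0, 0; split=> //; rewrite ?c1; lia.
have PQ : P :\: Q \subset P := subsetDl _ _.
have dPQ : [disjoint P :\: Q & S :|: Q].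
  rewrite disjoint_subset; apply/subsetP => z /setDP[zP zQ].
  by rewrite inE in_setU negb_or zQ (disjointFr dP zP).
have wS : w \notin S :|: Q by rewrite (disjointFr dPQ).
have wV := subsetP PV _ (subsetP PQ _ wP).
have wR := subsetP PR _ (subsetP PQ _ wP).
have [b1 BS1 lB1 _] := rd1.
(* [w] opens a new component and is attached to [B] alone, which loses one edge; the second [grow]
   then exhausts its component [K]. *)
have [F2 rd2 [s2 c2]] := attach rd1 wR wV wS RB (subxx B) BS1 (RB _ wR) lB1.
set P1 := (P :\: Q) :\ w.
have P1P : P1 \subset P := subset_trans (subD1set _ _) PQ.
have dP1 : [disjoint P1 & w |: (S :|: Q)].
  apply: disjoint_setU1; first exact: disjointWl (subD1set _ _) dPQ.
  by rewrite !inE eqxx.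
have [F3 [Q3 [rd3 s3 Q3P c3 h3]]] :=
  grow rd2 (subset_trans P1P PR) (subset_trans P1P PV) dP1 RB.
set K := w |: Q3.
have wQ3 : w \notin Q3 by apply/negP => /(subsetP Q3P); rewrite !inE eqxx.
have KPQ : K \subset P :\: Q.
  by rewrite subUset sub1set wP (subset_trans Q3P) // subD1set.
have eS3 : w |: (S :|: Q) :|: Q3 = S :|: Q :|: K.
  by rewrite /K [RHS]setUA [in RHS](setUC (S :|: Q)).
rewrite eS3 in rd3 h3.
have hP1 : P1 :\: Q3 = P :\: Q :\: K by rewrite /P1 /K -setDDl.
rewrite hP1 in h3.
have Kcl z : z \in K -> nbr z :&: R \subset K.
  move=> zK; apply/subsetP => p /setIP[]; rewrite inE => zp pR.
  apply: contraTT (zp) => pK.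
  have [pSQ|pSQ] := boolP (p \in S :|: Q).
    apply: h1; last by rewrite inE pSQ.
    exact: (subsetP KPQ).
  rewrite adjC; apply: h3.
    rewrite inE pK /=; move/subsetP: RS => /(_ _ pR).
    by move: pSQ; rewrite !inE negb_or => /andP[/negbTE-> ->].
  have zP := subsetP PQ _ (subsetP KPQ _ zK).
  by rewrite !inE (subsetP PR _ zP) andbT -/K -in_setU1 zK orbT.
have cK : #|P :\: Q| = #|K| + #|P :\: Q :\: K|.
  by rewrite -(cardsID K (P :\: Q)) (setIidPr KPQ).
have sumK (f : T -> nat) :
    \sum_(w in P :\: Q) f w = \sum_(w in K) f w + \sum_(w in P :\: Q :\: K) f w.
  by rewrite (big_setID K) /= (setIidPr KPQ).
have K0 : 0 < #|K| by rewrite cardsU1 wQ3.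
have PKP : P :\: Q :\: K \subset P := subset_trans (subsetDl _ _) PQ.
have eS : S :|: P = S :|: Q :|: K :|: (P :\: Q :\: K).
  by rewrite -{1}(setID P Q) (setIidPr QP) -{1}(setID (P :\: Q) K) (setIidPr KPQ) !setUA.
have [] := IH (P :\: Q :\: K) (S :|: Q :|: K) F3.
- by move: cP K0; rewrite cPQ cK; clear; lia.
- exact: rd3.
- exact: subset_trans PKP PR.
- by rewrite -eS.
- exact: subset_trans PKP PV.
- rewrite disjoint_subset; apply/subsetP => z /setDP[zPQ zK].
  by rewrite inE in_setU negb_or zK andbT (disjointFr dPQ zPQ).
- exact: RB.
- by move=> L z LP; apply: hK; apply: subset_trans LP PKP.
move=> F4 [i [b [rd4 s4 c4 h4 e4]]].
exists F4, i.+1; rewrite eS.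
have cKQ : #|K| = #|Q3|.+1 by rewrite cardsU1 wQ3.
have sF : F \subset F4.
  by apply: subset_trans s4; apply: subset_trans s3; apply: subset_trans s2.
have cF : #|B|.+1 * #|P| + #|F| <= #|F4| + i.+1.
  by move: c4; rewrite c3 c2 c1 cPQ cK cKQ !mulnDr !mulnS; clear; lia.
have Dsum : \sum_(w in P) D w =
    \sum_(w in Q) D w + (\sum_(w in K) D w + \sum_(w in P :\: Q :\: K) D w).
  by rewrite sumPQ sumK.
have [KH|KH] := leqP #|K| H.
  exists b; split=> //; last by move: e4 K0; rewrite cPQ cK; clear; lia.
  have HD : H <= \sum_(w in K) D w.
    (* Each vertex of [K] has deficit at least [H + 1 - #|K|], and [k * (H + 1 - k) >= H] for
       [1 <= k <= H]. *)
    apply: leq_trans (_ : #|K| * (H.+1 - #|K|) <= _).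
      by rewrite subSn // mulnS; have := leq_pmull (H - #|K|) K0; move: KH; clear; lia.
    rewrite -sum_nat_const; apply: leq_sum => z zK.
    have := hK K z (subset_trans KPQ PQ) zK (Kcl z zK); clear; lia.
  by move: HD h4; rewrite Dsum !mulSn; clear; lia.
exists b.+1; split=> //; first by move: h4; rewrite Dsum !mulSn; clear; lia.
by move: e4 KH; rewrite cPQ cK !mulSn; clear; lia.
Qed.

End Build.

(** * The lower bound *)

(* Here [h] and [h'] are the degrees of [x] and [y] minus [o]; [X], [Y], [pv] and
   [z] count the vertices whose neighbours in the triangle are just [x], just
   [y], just [v], or none, and [kx], [ky], [kv], [k0] the exceptional ones. *)
Lemma edge_excess_bound (D r h h' X Y z pv kv kx ky k0 bv bx bw b0 a b sv sx sy s0 : int) :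
  (0 <= kv -> 0 <= kx -> 0 <= ky -> 0 <= k0 ->
  0 <= bv -> 0 <= bx -> 0 <= bw -> 0 <= b0 ->
  1 <= h -> h' <= h -> 0 <= r -> r <= D -> z < D ->
  h + h' + pv + X + Y + z <= r + kv + kx + ky + k0 ->
  kv * h <= sv + bv * h -> kv + bv * h <= pv ->
  kx * h <= sx + bx * h -> kx + bx * h <= X ->
  ky * Num.max h' 0 <= sy + bw * Num.max h' 0 -> ky + bw * Num.max h' 0 <= Y ->
  k0 * D <= s0 + b0 * D -> k0 + b0 * D <= z ->
  a = h + Y + z -> b <= h' + X + z ->
  2 * (a * h' + (b + pv) * h - sv - sx - sy - s0) <= r ^+ 2)%R.
Proof.
set hp := Num.max h' 0%R.
move=> kv0 kx0 ky0 k00 bv0 bx0 by0 b00 h1 h'h r0 rD zD cnt Sv Pv Sx Px Sy Py S0 P0 -> bb.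
have hp0 : (0 <= hp)%R by rewrite /hp; lia.
have h'hp : (h' <= hp)%R by rewrite /hp; lia.
(* [b0 >= 1] would give [D <= z]. *)
have b0E : b0 = 0%R by nia.
rewrite {}b0E mul0r !addr0 in S0 P0.
move: hp hp0 h'hp Sy Py => hp hp0 h'hp Sy Py.
(* These count the non-exceptional vertices of each kind; they pay for the large components. *)
pose x0 := (X - kx)%R; pose y0 := (Y - ky)%R; pose p0 := (pv - kv)%R; pose z' := (z - k0)%R.
have [EX EY Ep Ez] : [/\ X = kx + x0, Y = ky + y0, pv = kv + p0 & z = k0 + z']%R.
  by rewrite /x0 /y0 /p0 /z'; split; lia.
move: x0 y0 p0 z' EX EY Ep Ez => x0 y0 p0 z' EX EY Ep Ez; subst X Y pv z.
have z'0 : (0 <= z')%R by lia.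
have x0b : (bx * h <= x0)%R by lia.
have y0b : (bw * hp <= y0)%R by lia.
have p0b : (bv * h <= p0)%R by lia.
have y00 : (0 <= y0)%R by nia.
have x00 : (0 <= x0)%R by nia.
have p00 : (0 <= p0)%R by nia.
set w := (x0 + y0 + p0)%R.
have h'b : (h' <= r - h - z' - w)%R by rewrite /w; lia.
have m1 : ((b + (kv + p0)) * h <= (h' + (kx + x0) + (k0 + z') + (kv + p0)) * h)%R.
  by apply: ler_wpM2r; lia.
have m2 : (ky * h' <= ky * hp)%R by apply: ler_wpM2l.
have m3 : (y0 * h' <= y0 * h)%R by apply: ler_wpM2l.
have m4 : ((h + k0 + z') * h' <= (h + k0 + z') * (r - h - z' - w))%R.
  by apply: ler_wpM2l => //; lia.
have m5 : (h * h' <= h * (r - h - z' - w))%R by apply: ler_wpM2l => //; lia.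
have m6 : (w <= (h + k0 + z') * w)%R by rewrite ler_peMl //; rewrite ?/w; lia.
have m7 : (0 <= k0 * (D - r + z'))%R by apply: mulr_ge0; lia.
(* In the sum of these bounds the terms in [w] are absorbed, leaving [h (r - h) + (h + z') (r - h -
   z') - k0 (D - r + z')], whose two products are at most [r ^+ 2 / 4] each. *)
have q1 : (0 <= (r - 2 * h) ^+ 2)%R by apply: sqr_ge0.
have q2 : (0 <= (r - 2 * (h + z')) ^+ 2)%R by apply: sqr_ge0.
rewrite /w in m4 m5 m6 *; rewrite !expr2 in q1 q2 *.
lia.
Qed.

(** As [a + b + pv = D], writing [dx = o + h] and [dy = o + h'] turns the degree sum into [2 D o]
    plus the excess bounded in [edge_excess_bound]. The truncated [dy - o] becomes the maximum with
    0. *)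
Lemma edge_count_bound (D o r dx dy X Y z pv kv kx ky k0 bv bx bw b0 a b sv sx sy s0 m : nat) :
  o < dx -> dy <= dx -> r <= D -> o <= D -> z < o ->
  2 * D + dx + dy + pv + X + Y + z <= 2 * (D + o) + r + kv + kx + ky + k0 ->
  kv * (dx - o) <= sv + bv * (dx - o) -> kv + bv * (dx - o) <= pv ->
  kx * (dx - o) <= sx + bx * (dx - o) -> kx + bx * (dx - o) <= X ->
  ky * (dy - o) <= sy + bw * (dy - o) -> ky + bw * (dy - o) <= Y ->
  k0 * D <= s0 + b0 * D -> k0 + b0 * D <= z ->
  a + o = dx + Y + z -> b + o <= dy + X + z -> a + b + pv = D ->
  2 * m + sv + sx + sy + s0 <= a * dy + b * dx + pv * dx + o * D ->
  4 * m <= 4 * (D * o) + r ^ 2.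
Proof.
move=> xo yx rD oD zo cnt Sv Pv Sx Px Sy Py S0 P0 Ea Eb Ec Em.
have hx : ((dx - o)%N%:Z = dx%:Z - o%:Z)%R by lia.
have hy : ((dy - o)%N%:Z = Num.max (dy%:Z - o%:Z) 0)%R by lia.
have := @edge_excess_bound D r (dx%:Z - o%:Z)%R (dy%:Z - o%:Z)%R X Y z pv kv kx ky k0
  bv bx bw b0 a b sv sx sy s0; rewrite -hy -hx.
have le (p q : nat) : p <= q -> (p%:Z <= q%:Z)%R by rewrite lez_nat.
move/le: Sv; move/le: Sx; move/le: Sy; move/le: S0.
move/le: Pv; move/le: Px; move/le: Py; move/le: P0.
rewrite !PoszD !PoszM => P0 Py Px Pv S0 Sy Sx Sv /(_ isT isT isT isT isT isT isT isT) EB.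
have {}EB := EB _ _ _ _ _ _ Sv Pv Sx Px Sy Py S0 P0.
have /EB {EB} : (1 <= (dx - o)%N%:Z)%R by lia.
have le1 : (dy%:Z - o%:Z <= (dx - o)%N%:Z)%R by lia.
have le2 : (z%:Z < D%:Z)%R by lia.
move=> /(_ le1 isT rD le2).
have le3 : ((dx - o)%N%:Z + (dy%:Z - o%:Z) + pv%:Z + X%:Z + Y%:Z + z%:Z
   <= r%:Z + kv%:Z + kx%:Z + ky%:Z + k0%:Z)%R by clear -cnt xo; lia.
have le4 : (a%:Z = (dx - o)%N%:Z + Y%:Z + z%:Z)%R by clear -Ea xo; lia.
have le5 : (b%:Z <= dy%:Z - o%:Z + X%:Z + z%:Z)%R by clear -Eb; lia.
move=> /(_ le3 le4 le5); rewrite hx.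
have DE : (D = a + b + pv) by [].
move: Em; rewrite {}DE; clear; rewrite expr2 -mulnn; lia.
Qed.

(** * Construction around a triangle of large degrees *)

Section Dense.
Variables (T : finType) (G : graph T).
Implicit Types (S B C R P Q K : {set T}) (F : {set {set T}}) (u v w : T).
Local Notation V := (vertices G).
Local Notation N := (nbr G).

Lemma card_nbr u : #|N u| = #|[set e in edges G | u \in e]|.
Proof.
rewrite -(card_imset _ (@set2_inj _ u)); apply: eq_card => e; rewrite inE.
apply/imsetP/andP => [[w]|[eE ue]].
  by rewrite inE => uw ->; rewrite set21.
have /cards2P[a [b [ab E]]] : #|e| == 2 by case/andP: (edge_valid eE).
move: ue; rewrite E !inE => /orP[]/eqP ?; subst u.
  by exists b; rewrite // inE /adj -E.
by exists a; rewrite 1?setUC // inE /adj setUC -E.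
Qed.

Lemma handshake : \sum_(u in V) #|N u| = 2 * #|edges G|.
Proof.
have -> : \sum_(u in V) #|N u| = \sum_(u in V) \sum_(e in edges G) (u \in e).
  apply: eq_bigr => u _; rewrite card_nbr -sum1_card big_mkcond [RHS]big_mkcond.
  by apply: eq_bigr => e _; rewrite inE; case: (e \in edges G); case: (u \in e).
rewrite exchange_big /= mulnC -sum_nat_const. apply: eq_bigr => e /edge_valid.
case/andP => eV /eqP <-; rewrite -sum1_card [RHS]big_mkcond [LHS]big_mkcond.
apply: eq_bigr => u _; case: (boolP (u \in e)) => [/(subsetP eV)->|] //.
by case: ifP.
Qed.

(** Within [R] the neighbours of [w] lie in [K] without [w]; outside [R] there are at most
    [#|V| - #|R|]. Thus small closed sets force small degrees. *)
Lemma card_nbr_closed K R w : w \in K -> N w :&: R \subset K ->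
  R \subset V -> #|N w| + #|R| < #|K| + #|V|.
Proof.
move=> wK s RV.
have : #|N w :&: R| < #|K|.
  apply: proper_card; rewrite properE s; apply/subsetPn; exists w => //.
  by rewrite !inE adj_irr.
rewrite -(cardsID R (N w)) -(cardsID R V) (setIidPr RV).
have : #|N w :\: R| <= #|V :\: R| by apply/subset_leq_card/setSD/nbr_sub.
by clear; lia.
Qed.

Lemma triangle_build v x y : adj G v x -> adj G v y -> adj G x y ->
  exists2 F, build G [set v; x; y] F & linked F [set v; x; y] /\ #|F| = 3.
Proof.
move=> vx vy xy.
have ne a b : adj G a b -> a != b by apply: contraTneq => ->; rewrite adj_irr.
have [] := @buildW _ G _ _ v set0 (build0 G) (adj_vertex vx); rewrite ?inE ?sub0set //.
  by move=> a; rewrite inE.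
rewrite setU0 => F1 b1 [_ c1 _].
have [] := @buildW _ G _ _ x [set v] b1 (adj_vertex xy) _ (subxx _).
- by rewrite inE eq_sym ne.
- by rewrite sub1set inE adjC.
- by move=> a b /set1P-> /set1P->; rewrite eqxx.
move=> F2 b2 [_ c2 h2].
have xv : [set x; v] \in F2 by apply: h2; rewrite inE.
have [] := @buildW _ G _ _ y [set x; v] b2 _ _ (subxx _).
- by rewrite adjC in xy; apply: adj_vertex xy.
- by rewrite !inE negb_or !(eq_sym y) !ne.
- by rewrite subUset !sub1set !inE adjC xy adjC.
- by move=> a b; rewrite !inE => /orP[]/eqP-> /orP[]/eqP->; rewrite ?eqxx // setUC.
move=> F3 b3 [s3 c3 h3].
have yx : [set y; x] \in F3 by apply: h3; rewrite !inE eqxx.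
have yv : [set y; v] \in F3 by apply: h3; rewrite !inE eqxx orbT.
have E : [set v; x; y] = y |: [set x; v] by rewrite setUC (setUC [set v]).
exists F3; rewrite E //; split; last first.
  by rewrite c3 c2 c1 !cards0 cards1 cards2 (eq_sym x v) ne.
move=> a b; rewrite !inE.
have xv3 := subsetP s3 _ xv.
by case/or3P => /eqP-> /or3P[]/eqP->; rewrite ?eqxx // => _; rewrite // setUC.
Qed.

(** Once sizes and sums are taken over one common set, the counting relations can be checked vertex
    by vertex, by cases on adjacency. *)
Lemma sum_indicator (A B : {set T}) (f : T -> nat) : A \subset B ->
  \sum_(u in A) f u = \sum_(u in B) (u \in A) * f u.
Proof.
move=> AB; rewrite [RHS](big_setID A) /= (setIidPr AB) [X in _ + X]big1 ?addn0.
  by apply: eq_bigr => u ->; rewrite mul1n.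
by move=> u /setDP[_ /negbTE->].
Qed.

Lemma card_indicator (A B : {set T}) : A \subset B ->
  #|A| = \sum_(u in B) (u \in A).
Proof.
by move=> AB; rewrite -sum1_card (sum_indicator _ AB); apply: eq_bigr => u _; rewrite muln1.
Qed.

Lemma readyW B R S S' F F' : ready G B R S F -> build G S' F' -> F \subset F' ->
  S \subset S' -> S' :&: R \subset S -> ready G B R S' F'.
Proof.
move=> [_ BS lB rB] b' FF' SS' S'R; split=> //; first exact: subset_trans SS'.
  exact: linkedW lB.
move=> p q pS qB; apply/(subsetP FF')/rB => //.
by rewrite inE (subsetP S'R) //; case/setIP: pS.
Qed.

Lemma dense_build v (r : nat) : v \in V ->
    (forall u, u \in V -> #|N u| <= #|N v|) -> #|V| <= 2 * #|N v| -> r <= #|N v| ->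
    4 * (#|N v| * (#|V| - #|N v|)) + r ^ 2 < 4 * #|edges G| ->
  exists S F, build G S F /\ 2 * #|V| + r < #|F| + #|N v| + 3.
Proof.
move=> vV vmax VD rD; set D := #|N v| in vmax VD rD *; set o := #|V| - D => mD.
have hs := handshake.
have DV : D <= #|V| by apply/subset_leq_card/nbr_sub.
have cVN : #|V :\: N v| = o by rewrite cardsD (setIidPr (nbr_sub _ _)).
(* If every neighbour of [v] had degree at most [o], the degree sum would be at most [2 D o]. *)
have [/existsP[x0 /andP[x0v x0o]]|no] := boolP [exists u, (u \in N v) && (o < #|N u|)]; last first.
  have : \sum_(u in V) #|N u| <= D * o + o * D.
    rewrite (big_setID (N v)) /= (setIidPr (nbr_sub _ _)); apply: leq_add.
      rewrite -sum_nat_const; apply: leq_sum => u uv; rewrite leqNgt.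
      by apply: contra no => uo; apply/existsP; exists u; rewrite uv.
    by rewrite -cVN -sum_nat_const; apply: leq_sum => u /setDP[/vmax].
  by rewrite hs; move: mD; clear; lia.
have [x /= xv xmax] := arg_maxnP (P := fun u => u \in N v) (fun u => #|N u|) x0v.
have {x0 x0v x0o} xo : o < #|N x| := leq_trans x0o (xmax _ x0v).
(* Only [o] vertices lie outside [N v], fewer than the degree of [x]. *)
have /set0Pn[y0 y0vx] : N v :&: N x != set0.
  apply: contraTneq xo => vx0; rewrite -leqNgt -cVN; apply: subset_leq_card.
  rewrite subsetD nbr_sub -setI_eq0 setIC; exact/eqP.
have [y /= yvx ymax] := arg_maxnP (P := fun u => u \in N v :&: N x) (fun u => #|N u|) y0vx.
have {y0 y0vx yvx} [yv yx] := setIP yvx.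
have yxd : #|N y| <= #|N x| by apply: xmax.
have Avx : adj G v x by move: xv; rewrite inE.
have Avy : adj G v y by move: yv; rewrite inE.
have Axy : adj G x y by move: yx; rewrite inE.
have [Axv Ayv Ayx] : [/\ adj G x v, adj G y v & adj G y x] by split; rewrite adjC.
have [F0 b0 [l0 c0]] := triangle_build Avx Avy Axy.
set T0 := [set v; x; y] in b0 l0.
pose cnt u := adj G v u + adj G x u + adj G y u.
(* [S1] contains the triangle itself; together with [Pv], [Px], [Py] and [P0] it partitions [V]. *)
pose S1 := [set u in V | 2 <= cnt u].
pose Pv := [set u in V | [&& adj G v u, ~~ adj G x u & ~~ adj G y u]].
pose Px := [set u in V | [&& adj G x u, ~~ adj G v u & ~~ adj G y u]].
pose Py := [set u in V | [&& adj G y u, ~~ adj G v u & ~~ adj G x u]].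
pose P0 := [set u in V | [&& ~~ adj G v u, ~~ adj G x u & ~~ adj G y u]].
have subV (p : pred T) : [set u in V | p u] \subset V.
  by apply/subsetP => u; rewrite inE => /andP[].
have T0S1 : T0 \subset S1.
  apply/subsetP => u; rewrite !inE -orbA => /or3P[]/eqP->; rewrite /cnt.
  - by rewrite vV adj_irr Axv Ayv.
  - by rewrite (adj_vertex Axy) adj_irr Avx Ayx.
  - by rewrite (adj_vertex Ayx) adj_irr Avy Axy.
have cap u : #|N u :&: T0| = cnt u.
  have vx : v != x by apply: contraTneq Avx => ->; rewrite adj_irr.
  have vy : v != y by apply: contraTneq Avy => ->; rewrite adj_irr.
  have xy : x != y by apply: contraTneq Axy => ->; rewrite adj_irr.
  rewrite (card_indicator (subsetIr _ _)) /T0 -setUA big_setU1 /=; last first.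
    by rewrite !inE negb_or vx.
  rewrite big_setU1 ?inE //= big_set1 !inE !eqxx !orbT !andbT /=.
  by rewrite addnA /cnt !(adjC _ u).
have [F1 b1 [s1 c1 h1]] : exists2 F', build G S1 F' &
    [/\ F0 \subset F', #|F'| = #|F0| + \sum_(u in S1 :\: T0) cnt u &
        forall u c, u \in S1 :\: T0 -> c \in N u :&: T0 -> [set u; c] \in F'].
  have [] := attach_all b0 (subxx _) l0 (P := S1 :\: T0).
  - exact: subset_trans (subsetDl _ _) (subV _).
  - by rewrite disjoint_subset; apply/subsetP => z /setDP[_].
  have -> : T0 :|: S1 :\: T0 = S1 by rewrite -{1}(setIidPr T0S1) setID.
  move=> F1 b1 [s1 c1 h1].
  by exists F1 => //; split=> //; rewrite c1; congr (_ + _); apply: eq_bigr => u _.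
have rdy t : t \in T0 -> ready G [set t] (N t) S1 F1.
  move=> tT; split=> //; first by rewrite sub1set (subsetP T0S1).
    by move=> a b /set1P-> /set1P->; rewrite eqxx.
  move=> p b /setIP[pS pt] /set1P->.
  have [pT|pT] := boolP (p \in T0).
    apply/(subsetP s1)/l0 => //.
    by apply: contraTneq pt => ->; rewrite inE adj_irr.
  apply: h1; first by rewrite inE pT.
  by rewrite in_setI tT andbT inE adjC; move: pt; rewrite inE.
have NR t : {in N t, forall q, [set t] \subset N q}.
  by move=> q; rewrite sub1set !inE adjC.
(* One phase attaches the vertices whose only triangle neighbour is [t]; [f] is the deficit of a
   degree below the bound known for its class. *)
have phase t S F P (f : T -> nat) H : t \in T0 -> build G S F -> F1 \subset F ->
    S1 \subset S -> S :&: N t \subset S1 -> P \subset N t -> N t \subset S :|: P ->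
    [disjoint P & S] ->
    (forall w k, w \in V -> 0 < k -> #|N w| + #|N t| < k + #|V| -> H < f w + k) ->
  exists F' i b, [/\ build G (S :|: P) F', F1 \subset F', 2 * #|P| + #|F| <= #|F'| + i,
    i * H <= \sum_(w in P) f w + b * H & i + b * H <= #|P|].
  move=> tT bS F1F S1S SN PN NP dP fH.
  have rd := readyW (rdy t tT) bS F1F S1S SN.
  have PV := subset_trans PN (nbr_sub G t).
  have [|F' [i [b [[b' _ _ _] s' c' e1 e2]]]] :=
    attach_components (H := H) (D := f) rd PN NP PV dP (@NR t).
    move=> K w KP wK wN; apply: fH; first by rewrite (subsetP PV) // (subsetP KP).
      by apply/card_gt0P; exists w.
    exact: card_nbr_closed wK wN (nbr_sub _ _).
  by exists F', i, b; split=> //; [exact: subset_trans s' | move: c'; rewrite cards1].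
have bb (e1 e2 e3 : bool) : (1 < e1 + e2 + e3) = [|| e1 && e2, e1 && e3 | e2 && e3].
  by case: e1 e2 e3 => [] [] [].
have tau : [/\ v \in T0, x \in T0 & y \in T0] by rewrite !inE !eqxx !orbT.
case: tau => vT xT yT.
have nV t u : (u \in N t) = (u \in V) && adj G t u.
  rewrite inE andbC; case: (boolP (adj G t u)) => //= tu.
  by rewrite adjC in tu; rewrite (adj_vertex tu).
have sbs (A B : {set T}) : (forall u, u \in V -> u \in A -> u \in B) -> A \subset V -> A \subset B.
  by move=> h /subsetP AV; apply/subsetP => u uA; apply: h => //; apply: AV.
have dsj (A B : {set T}) : (forall u, u \in V -> u \in A -> u \notin B) ->
    A \subset V -> [disjoint A & B].
  by move=> h /subsetP AV; rewrite disjoint_subset; apply/subsetP => u uA;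
    apply: h => //; apply: AV.
(* [card_nbr_closed] with [R = N t] keeps degrees in [K] below [#|K| + #|V| - #|N t|]. Measured
   against [#|N x|] for [t = v], and against [D] for [t = x] or [y], this gives the thresholds [h],
   [h] and [h']. *)
set h := #|N x| - o; set h' := #|N y| - o.
have [F2 [iv [bv [b2 s2 c2 ev lv]]]] : exists F' i b,
    [/\ build G (S1 :|: Pv) F', F1 \subset F', 2 * #|Pv| + #|F1| <= #|F'| + i,
    i * h <= \sum_(w in Pv) (#|N x| - #|N w|) + b * h & i + b * h <= #|Pv|].
  apply: (phase v S1 F1 Pv _ h vT b1 (subxx _) (subxx _) (subsetIl _ _)).
  - by apply: (sbs _ _ _ (subV _)) => u uV; rewrite !inE uV; case: (adj G v u).
  - apply: (sbs _ _ _ (nbr_sub _ _)) => u uV; rewrite !inE uV /cnt bb.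
    by case: (adj G v u); case: (adj G x u); case: (adj G y u).
  - apply: (dsj _ _ _ (subV _)) => u uV; rewrite !inE uV /cnt bb.
    by case: (adj G v u); case: (adj G x u); case: (adj G y u).
  - move=> w k /vmax; rewrite /h /o -/D; move: DV xo; rewrite /o; clear; lia.
have [F3 [ix [bx [b3 s3 c3 ex lx]]]] : exists F' i b,
    [/\ build G (S1 :|: Pv :|: Px) F', F1 \subset F', 2 * #|Px| + #|F2| <= #|F'| + i,
    i * h <= \sum_(w in Px) (D - #|N w|) + b * h & i + b * h <= #|Px|].
  apply: (phase x _ F2 Px _ h xT b2 s2 (subsetUl _ _)).
  - apply: (sbs _ _ _ (subset_trans (subsetIr _ _) (nbr_sub _ _))) => u uV.
    rewrite !inE uV /cnt bb.
    by case: (adj G v u); case: (adj G x u); case: (adj G y u).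
  - by apply: (sbs _ _ _ (subV _)) => u uV; rewrite !inE uV; case: (adj G x u).
  - apply: (sbs _ _ _ (nbr_sub _ _)) => u uV; rewrite !inE uV /cnt bb.
    by case: (adj G v u); case: (adj G x u); case: (adj G y u).
  - apply: (dsj _ _ _ (subV _)) => u uV; rewrite !inE uV /cnt bb.
    by case: (adj G v u); case: (adj G x u); case: (adj G y u).
  - move=> w k /vmax; rewrite /h /o -/D; move: DV xo; rewrite /o; clear; lia.
have [F4 [iy [bw [b4 s4 c4 ey ly]]]] : exists F' i b,
    [/\ build G (S1 :|: Pv :|: Px :|: Py) F', F1 \subset F', 2 * #|Py| + #|F3| <= #|F'| + i,
    i * h' <= \sum_(w in Py) (D - #|N w|) + b * h' & i + b * h' <= #|Py|].
  apply: (phase y _ F3 Py _ h' yT b3 s3); rewrite ?(subset_trans _ (subsetUl _ Px)) ?subsetUl //.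
  - apply: (sbs _ _ _ (subset_trans (subsetIr _ _) (nbr_sub _ _))) => u uV.
    rewrite !inE uV /cnt bb.
    by case: (adj G v u); case: (adj G x u); case: (adj G y u).
  - by apply: (sbs _ _ _ (subV _)) => u uV; rewrite !inE uV; case: (adj G y u).
  - apply: (sbs _ _ _ (nbr_sub _ _)) => u uV; rewrite !inE uV /cnt bb.
    by case: (adj G v u); case: (adj G x u); case: (adj G y u).
  - apply: (dsj _ _ _ (subV _)) => u uV; rewrite !inE uV /cnt bb.
    by case: (adj G v u); case: (adj G x u); case: (adj G y u).
  - move=> w k /vmax; rewrite /h' /o -/D; move: DV; clear; lia.
(* With [B] empty and [R = V], the components are those of [G], and the threshold is [D]. *)
have [F5 [i0 [b0' [[b5 _ _ _] s5 c5 e0 l0']]]] : exists F' i b,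
    [/\ ready G set0 V (S1 :|: Pv :|: Px :|: Py :|: P0) F', F4 \subset F',
    #|(set0 : {set T})|.+1 * #|P0| + #|F4| <= #|F'| + i,
    i * D <= \sum_(w in P0) (D - #|N w|) + b * D & i + b * D <= #|P0|].
  apply: attach_components.
  - by split; rewrite ?sub0set // => a b; rewrite ?inE // => _; rewrite inE.
  - exact: subV.
  - apply: (sbs _ _ _ (subxx _)) => u uV _; rewrite !inE uV /cnt bb.
    by case: (adj G v u); case: (adj G x u); case: (adj G y u).
  - exact: subV.
  - apply: (dsj _ _ _ (subV _)) => u uV; rewrite !inE uV /cnt bb.
    by case: (adj G v u); case: (adj G x u); case: (adj G y u).
  - by move=> q _; apply: sub0set.
  - move=> K w _ wK wc; have := card_nbr_closed wK wc (subxx _); clear; lia.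
exists (S1 :|: Pv :|: Px :|: Py :|: P0), F5; split=> //.
rewrite ltnNge; apply/negP => few.
have cT0 u : u \in T0 -> cnt u = 2.
  rewrite !inE -orbA => /or3P[]/eqP->; rewrite /cnt adj_irr.
  - by rewrite Axv Ayv.
  - by rewrite Avx Ayx.
  - by rewrite Avy Axy.
have T0V : T0 \subset V := subset_trans T0S1 (subV _).
have T03 : #|T0| <= 3.
  by rewrite /T0 -setUA cardsU1 cards2; case: (_ \notin _); case: (_ != _).
(* [N v] splits into [A], [A'] and [Pv], with degrees at most [#|N y|], [#|N x|] and [#|N x|]. *)
pose A := N v :&: N x; pose A' := (N v :&: N y) :\: N x.
have AV : A \subset V by rewrite subIset // nbr_sub.
have A'V : A' \subset V.
  by apply: subset_trans (subsetDl _ _) _; rewrite subIset // nbr_sub.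
(* The left side sums [cnt] over all vertices; [cnt] is 2 on [T0] and 1 on [Pv], [Px], [Py]. *)
have E1 : D + #|N x| + #|N y| <=
    2 * #|T0| + \sum_(u in S1 :\: T0) cnt u + #|Pv| + #|Px| + #|Py|.
  rewrite /D !(card_indicator (nbr_sub _ _)) (card_indicator T0V) !(card_indicator (subV _)).
  rewrite (sum_indicator _ (subset_trans (subsetDl _ _) (subV _))) big_distrr /= -!big_split /=.
  apply: leq_sum => u uV; rewrite in_setD.
  have [uT|uT] := boolP (u \in T0); first by rewrite !nV uV /= -/(cnt u) cT0.
  rewrite !inE uV /cnt bb.
  by case: (adj G v u); case: (adj G x u); case: (adj G y u).
(* The deficits only fill the gap between a degree and the bound of its class; outside [N v] that
   bound is [D]. *)
have E2 : \sum_(u in V) #|N u| + \sum_(u in Pv) (#|N x| - #|N u|)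
    + \sum_(u in Px) (D - #|N u|) + \sum_(u in Py) (D - #|N u|) + \sum_(u in P0) (D - #|N u|)
    <= #|A| * #|N y| + #|A'| * #|N x| + #|Pv| * #|N x| + o * D.
  rewrite -cVN !(sum_indicator _ (subV _)) (card_indicator AV) (card_indicator A'V).
  rewrite !(card_indicator (subV _)) (card_indicator (subsetDl _ _)) !big_distrl /= -!big_split /=.
  apply: leq_sum => u uV; have uD := vmax u uV.
  have ux : adj G v u -> #|N u| <= #|N x| by move=> vu; apply: xmax; rewrite inE.
  have uy : adj G v u -> adj G x u -> #|N u| <= #|N y|.
    by move=> vu xu; apply: ymax; rewrite !inE vu xu.
  move: uD ux uy; rewrite !inE uV; clear.
  case: (adj G v u); case: (adj G x u); case: (adj G y u) => //= uD ux uy;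
  rewrite ?mul1n ?mul0n ?addn0 ?add0n; (try have := ux isT); (try have := uy isT isT); lia.
have E3 : #|A| + o = #|N x| + #|Py| + #|P0|.
  rewrite -cVN (card_indicator AV) (card_indicator (subsetDl _ _)).
  rewrite (card_indicator (nbr_sub _ _)) !(card_indicator (subV _)) -!big_split /=.
  apply: eq_bigr => u uV; rewrite !inE uV.
  by case: (adj G v u); case: (adj G x u); case: (adj G y u).
have E4 : #|A'| + o <= #|N y| + #|Px| + #|P0|.
  rewrite -cVN (card_indicator A'V) (card_indicator (subsetDl _ _)).
  rewrite (card_indicator (nbr_sub _ _)) !(card_indicator (subV _)) -!big_split /=.
  apply: leq_sum => u uV; rewrite !inE uV.
  by case: (adj G v u); case: (adj G x u); case: (adj G y u).
have E5 : #|A| + #|A'| + #|Pv| = D.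
  rewrite /D (card_indicator AV) (card_indicator A'V).
  rewrite (card_indicator (nbr_sub _ _)) !(card_indicator (subV _)) -!big_split /=.
  apply: eq_bigr => u uV; rewrite !inE uV.
  by case: (adj G v u); case: (adj G x u); case: (adj G y u).
have E6 : #|P0| < o.
  rewrite -cVN; apply: proper_card; apply/properP; split.
    by apply: (sbs _ _ _ (subV _)) => u uV; rewrite !inE uV; case: (adj G v u).
  by exists v; rewrite !inE ?vV ?adj_irr // Axv andbF.
have VE : #|V| = D + o by rewrite /o subnKC.
have oD : o <= D by move: VD; rewrite VE; clear; lia.
have count : 2 * D + #|N x| + #|N y| + #|Pv| + #|Px| + #|Py| + #|P0|
    <= 2 * (D + o) + r + iv + ix + iy + i0.
  move: few E1 c5 c4 c3 c2 c1 c0 T03; rewrite VE cards0 mul1n; clear.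
  clearbody o D; move: (\sum_(u in S1 :\: T0) cnt u) (#|F0|) (#|F1|) (#|F2|) (#|F3|)
    (#|F4|) (#|F5|) (#|T0|) (#|P0|) (#|Px|) (#|Py|) (#|Pv|) (#|N x|) (#|N y|).
  by lia.
rewrite hs in E2.
have := edge_count_bound xo yxd rD oD E6 count ev lv ex lx ey ly e0 l0' E3 E4 E5 E2.
by move: mD; clear; lia.
Qed.

End Dense.

(** * Forests in chordal graphs *)

Section Forest.
Variables (T : finType) (H : graph T).
Implicit Types (X : {set T}) (s : seq T).

Definition triangle_free X :=
  {in X & &, forall a b c, adj H a b -> adj H b c -> ~~ adj H a c}.

Definition induced_path X s :=
  [/\ uniq s, {subset s <= X} & forall x i k, i < size s -> k < size s ->
     adj H (nth x s i) (nth x s k) = (i.+1 == k) || (k.+1 == i)].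

(** Since [j] is the first positive index at which [y] meets the path, closing the path there
    through [y] creates no chord. *)
Lemma induced_path_cycle X s x y j : induced_path X (x :: s) -> y \in X ->
    y \notin x :: s -> adj H y x -> 0 < j < (size s).+1 -> adj H y (nth x (x :: s) j) ->
    (forall k, 0 < k < j -> ~~ adj H y (nth x (x :: s) k)) ->
  induced_cycle H (y :: take j.+1 (x :: s)).
Proof.
move=> [Us sX sadj] yX ys yx /andP[j0 js] yj jmin.
set p := take j.+1 (x :: s).
have sp : size p = j.+1 by rewrite size_takel.
have np i : i <= j -> nth y p i = nth x (x :: s) i.
  by move=> ij; rewrite nth_take //; apply: set_nth_default => /=; lia.
have Uc : uniq (y :: p).
  by rewrite cons_uniq (take_uniq _ Us) andbT; apply: contra ys => /mem_take.
(* Positions in the cycle run from 0, that of [y], to [j.+1]; [nx] is their cyclic successor. *)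
clearbody p; pose nx i := if i == j.+1 then 0 else i.+1.
have nextE i : i < j.+2 -> next (y :: p) (nth y (y :: p) i) = nth y (y :: p) (nx i).
  move=> ij; rewrite next_nth mem_nth ?index_uniq //= ?sp // /nx.
  by case: eqP => [->|_] //; rewrite nth_default ?sp.
have cadj : forall i k, i < j.+2 -> k < j.+2 ->
    adj H (nth y (y :: p) i) (nth y (y :: p) k) = (k == nx i) || (i == nx k).
  move=> i k; have y1 l : l < j.+1 -> adj H y (nth y p l) = (l == 0) || (l == j).
    move=> kj; rewrite np //; case: (posnP l) => [->|k0] //=.
    have [->|kj'] := eqVneq l j; first by rewrite yj.
    by rewrite (negbTE (jmin l _)) ?k0 ?ltn_neqAle ?kj' //=; lia.
  case: i k => [|i] [|k] ij kj; rewrite /nx /=.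
  - by rewrite adj_irr; case: j {y1 jmin np nextE nx sp p Uc js yj} j0 ij kj.
  - by rewrite y1 // !eqSS; case: (k == j); rewrite ?orbT ?orbF.
  - by rewrite adjC y1 // !eqSS; case: (i == j); rewrite ?orbT ?orbF.
  - rewrite !np // sadj; [|move: ij js; clear; rewrite /=; lia|move: kj js; clear; rewrite /=; lia].
    rewrite !eqSS; case: (eqVneq i j) => [->|_]; case: (eqVneq k j) => [->|_];
    by move: ij kj; clear; lia.
split; [by rewrite /= sp; lia | exact: Uc | |].
- move=> u; rewrite inE => /orP[/eqP->|up]; first exact: adj_vertex yx.
  move: up => /(nthP y) [i]; rewrite sp => ij <-.
  have := @cadj i.+1 (nx i.+1); rewrite eqxx /= => c1.
  apply: (@adj_vertex _ H _ (nth y (y :: p) (nx i.+1))); apply: c1 => //.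
  by rewrite /nx; case: ifP => //; lia.
- move=> a b /(nthP y)[i ij <-] /(nthP y)[k kj <-].
  have sc : size (y :: p) = j.+2 by rewrite -sp.
  move: ij kj; rewrite sc => ij kj.
  have nxb l : l < j.+2 -> nx l < j.+2 by rewrite /nx; case: ifP => //; lia.
  by rewrite !nextE // cadj // !nth_uniq ?sc ?nxb.
Qed.

(** If all degrees inside [X] were at least 2, an induced path could be extended at its head
    forever: a new neighbour that sees the path again closes a triangle or an induced cycle of
    length at least 4. *)
Lemma chordal_no_core X : chordal H -> triangle_free X -> X != set0 ->
  exists2 x, x \in X & #|nbr H x :&: X| <= 1.
Proof.
move=> cH tf /set0Pn[x0 x0X].
have [/existsP[x /andP[]]|no] := boolP [exists x, (x \in X) && (#|nbr H x :&: X| <= 1)].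
  by exists x.
suff K k x s : #|X| - size (x :: s) = k -> ~ induced_path X (x :: s).
  case: (K _ x0 [::] erefl); split=> // [u|z [|i] [|l]] //=.
    by rewrite inE => /eqP->.
  by rewrite adj_irr.
elim/ltn_ind: k x s => k IH x s sk ip; have [Us sX sadj] := ip.
have xX : x \in X by apply: sX; rewrite mem_head.
(* [y] avoids the second vertex of the path; for empty [s] the default is [x], which is no neighbour
   of [x]. *)
have [y yN yz] : exists2 y, y \in nbr H x :&: X & y != nth x s 0.
  have /set0Pn[y /setD1P[yz yN]] : (nbr H x :&: X) :\ nth x s 0 != set0.
    rewrite -card_gt0 (leq_trans _ (_ : #|nbr H x :&: X| - 1 <= _)) ?subn_gt0 //.
      by rewrite ltnNge; apply: contra no => xd; apply/existsP; exists x; rewrite xX.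
    by rewrite (cardsD1 (nth x s 0) (nbr H x :&: X)); case: (_ \in _); lia.
  by exists y.
have [xy yX] := setIP yN; rewrite inE in xy.
have ys : y \notin x :: s.
  apply/negP => /(nthP x)[[|i] il /= e]; first by rewrite -e adj_irr in xy.
  have := sadj x 0 i.+1 isT il; rewrite /= e xy => /esym.
  by case: i il e => //= il e _; rewrite e eqxx in yz.
rewrite adjC in xy.
pose P j := (0 < j < (size s).+1) && adj H y (nth x (x :: s) j).
have [/existsP[j0 Pj0]|nP] := boolP [exists j : 'I_(size s).+1, P j].
  have exP : exists j, P j by exists j0.
  have [j /andP[js yj] jmin] := ex_minnP exP.
  have jmin' l : 0 < l < j -> ~~ adj H y (nth x (x :: s) l).
    move=> /andP[l0 lj]; apply: contraTN (lj) => yl; rewrite -leqNgt; apply: jmin.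
    by case/andP: js => _ js; rewrite /P l0 yl andbT /= (ltn_trans lj).
  have := cH _ (induced_path_cycle ip yX ys xy js yj jmin').
  rewrite /= size_takel; last by case/andP: js.
  (* Index 1 gives the triangle; a larger one gives a cycle of [j + 2 >= 4] vertices. *)
  case: j js yj {jmin jmin'} => [|[|j]] //= js yj _.
  have := tf y x (nth x s 0) yX xX _ xy _; rewrite yj => F.
  have s0 : 0 < size s by move: js; lia.
  suff : false by []; apply: F.
    by apply: sX; rewrite inE mem_nth ?orbT.
  by have := sadj x 0 1 isT; rewrite /= => -> //.
have ip' : induced_path X (y :: x :: s).
  split; first by rewrite cons_uniq ys Us.
    by move=> u; rewrite inE => /orP[/eqP->|/sX].
  have y1 z l : l < (size s).+1 -> adj H y (nth z (x :: s) l) = (l == 0).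
    case: l => [|l] ls //=.
    apply: contraNF nP => yl; apply/existsP; exists (Ordinal (ls : l.+1 < (size s).+1)).
    by rewrite /P /= ls /= (set_nth_default z).
  move=> z [|i] [|l] il ll.
  - by rewrite adj_irr.
  - change (adj H y (nth z (x :: s) l) = (1 == l.+1) || (l.+2 == 0)).
    by rewrite y1 // eqSS eq_sym orbF.
  - change (adj H (nth z (x :: s) i) y = (i.+2 == 0) || (1 == i.+1)).
    by rewrite adjC y1 // eqSS eq_sym.
  - exact: sadj.
have sz : size (y :: x :: s) <= #|X|.
  by case: ip' => U' X' _; rewrite cardE; apply: uniq_leq_size U' _ => u /X'; rewrite mem_enum.
apply: (IH _ _ y (x :: s) erefl ip'); rewrite -sk.
by move: sz => /=; lia.
Qed.

(** Deleting the vertex found by [chordal_no_core] loses at most one edge, which gives the forest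
    bound by induction. *)
Lemma chordal_forest X : chordal H -> triangle_free X -> X != set0 ->
  #|[set e in edges H | e \subset X]| < #|X|.
Proof.
move=> cH; move: {2}#|X| (leqnn #|X|) => k.
elim: k X => [|k IH] X cX tf X0.
  by move: X0; rewrite -card_gt0; case: #|X| cX.
have [x xX dx] := chordal_no_core cH tf X0.
have sub : [set e in edges H | e \subset X] \subset
    [set e in edges H | e \subset X :\ x] :|: [set [set x; u] | u in nbr H x :&: X].
  apply/subsetP => e; rewrite !inE => /andP[eE eX]; rewrite eE /=.
  have [xe|xe] := boolP (x \in e); last first.
    by rewrite subsetD1 eX xe.
  apply/orP; right; have /cards2P[a [b [ab E]]] : #|e| == 2 by case/andP: (edge_valid eE).
  have := eX; move: xe; rewrite E !inE subUset !sub1set => /orP[]/eqP ? /andP[aX bX]; subst x.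
    by apply/imsetP; exists b; rewrite // !inE /adj -E eE.
  by apply/imsetP; exists a; [rewrite !inE /adj setUC -E eE | rewrite setUC].
apply: leq_ltn_trans (subset_leq_card sub) _.
apply: leq_ltn_trans (leq_card_setU _ _) _.
have cI := leq_imset_card (fun u => [set x; u]) (nbr H x :&: X).
have cXx : #|X| = #|X :\ x|.+1 by rewrite (cardsD1 x) xX.
have [X1|X1] := eqVneq (X :\ x) set0.
  rewrite (_ : [set e in _ | _] = set0); last first.
    apply/setP => e; rewrite !inE X1; apply/negbTE/negP => /andP[/edge_valid/andP[_ e2]].
    by rewrite subset0 => /eqP e0; rewrite e0 cards0 in e2.
  rewrite cards0 add0n (leq_ltn_trans cI) // cXx X1 cards0.
  rewrite ltnS leqn0 cards_eq0; apply/eqP/setP => u; rewrite !inE.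
  apply/negbTE/negP => /andP[xu uX]; move/setP: X1 => /(_ u); rewrite !inE uX andbT.
  by move/negbT/negPn/eqP => e; rewrite e adj_irr in xu.
have := IH (X :\ x) _ _ X1; rewrite cXx in cX * => IH'.
have {}IH' := IH' cX _; apply: leq_trans (_ : _ < #|X :\ x| + 1) _; last by rewrite addn1.
apply: leq_trans (leq_add (IH' _) (leq_trans cI dx)).
  by rewrite addSn.
by move=> a b c /setD1P[_ aX] /setD1P[_ bX] /setD1P[_ cX']; apply: tf.
Qed.

End Forest.

(** * Turan numbers and the extremal graph *)

Definition bipartite_edges (T : finType) (A B : {set T}) : {set {set T}} :=
  [set [set p.1; p.2] | p in setX A B].

Lemma card_bipartite_edges (T : finType) (A B : {set T}) : [disjoint A & B] ->
  #|bipartite_edges A B| = #|A| * #|B|.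
Proof.
move=> dAB; rewrite card_in_imset ?cardsX // => -[a b] [a' b'] /=.
case/setXP => /= aA bB /setXP[/= a'A b'B] /setP E.
have : a \in [set a'; b'] by rewrite -E set21.
have : b \in [set a'; b'] by rewrite -E set22.
rewrite !inE => /orP[]/eqP Eb; first by rewrite -Eb (disjointFl dAB) in a'A.
by case/orP=> /eqP Ea; [rewrite Ea Eb | rewrite -Ea (disjointFr dAB) in b'B].
Qed.

Lemma in_bipartite_edges (T : finType) (A B : {set T}) a b :
  a \in A -> b \in B -> [set a; b] \in bipartite_edges A B.
Proof. by move=> aA bB; apply/imsetP; exists (a, b); rewrite ?inE ?aA. Qed.

Lemma card_odd_ord n : #|[set i : 'I_n | odd i]| = n./2.
Proof.
rewrite -sum1_card big_mkcond /= (eq_bigr (fun i : 'I_n => odd i : nat)); last first.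
  by move=> i _; rewrite inE; case: odd.
by elim: n => [|n IH]; rewrite ?big_ord0 // big_ord_recr /= IH uphalf_half addnC.
Qed.

Lemma card_interval_ord n a b : b <= n -> #|[set i : 'I_n | a <= i < b]| = b - a.
Proof.
move=> bn; rewrite -sum1_card big_mkcond /=.
rewrite (eq_bigr (fun i : 'I_n => (a <= i < b) : nat)); last first.
  by move=> i _; rewrite inE; case: (_ <= _ < _).
elim: n b bn => [|n IH] b bn; first by move: bn; rewrite big_ord0; lia.
rewrite big_ord_recr /=; move: bn; rewrite leq_eqVlt => /orP[/eqP->|bn].
  have := IH n (leqnn n).
  rewrite (eq_bigr (fun i : 'I_n => (a <= i < n.+1) : nat)) => [->|i _]; first by lia.
  by have := ltn_ord i; lia.
by rewrite IH //; lia.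
Qed.

Lemma turan_number2 n : turan_number 2 n = n./2 * (n - n./2).
Proof.
pose O := [set i : 'I_n | odd i].
have -> : n./2 * (n - n./2) = #|O| * #|~: O|.
  by rewrite [#|~: O|]cardsCs setCK card_ord card_odd_ord.
rewrite /turan_number /= -card_bipartite_edges; last first.
  by rewrite -setI_eq0 setICr.
apply: eq_card => e; apply/imsetP/imsetP => -[[i j]] /=; rewrite !inE /= => ij ->.
  move: ij; rewrite !modn2; case oi: (odd i); case oj: (odd j) => // _.
    by exists (i, j); rewrite ?inE /= ?oi ?oj.
  by exists (j, i); rewrite ?inE /= ?oi ?oj // setUC.
by exists (i, j); rewrite ?inE //= !modn2; move: ij; case: (odd i); case: (odd j).
Qed.

(** The floor of [n^2 / 4] in a form that arithmetic tactics can use. *)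
Lemma turan_number2_bounds n : 4 * turan_number 2 n <= n ^ 2 <= 4 * turan_number 2 n + 1.
Proof.
rewrite turan_number2; have E := odd_double_half n.
move: (n./2) (odd n) E => k b <-; rewrite -mulnn.
by case: b; rewrite /= ?add1n ?add0n -addnn; apply/andP; split; nia.
Qed.

(** Take out one part of the Turan graph: the [t] vertices outside it carry a bipartite graph
    between the other two parts, with at most [t^2 / 4] edges. *)
Lemma turan_number3_le n : exists2 t, t <= n &
  turan_number 3 n <= t * (n - t) + turan_number 2 t.
Proof.
pose c j := [set i : 'I_n | i %% 3 == j].
have sub : turan_edges 3 n \subset
    bipartite_edges (c 0) (~: c 0) :|: bipartite_edges (c 1) (c 2).
  apply/subsetP => _ /imsetP[[i j] ij ->]; rewrite inE /= in ij.
  have i3 := ltn_pmod i (isT : 0 < 3); have j3 := ltn_pmod j (isT : 0 < 3).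
  rewrite /= inE.
  have [i0|i0] := eqVneq (i %% 3) 0.
    apply/orP; left; apply: in_bipartite_edges; rewrite !inE ?i0 //.
    by move: ij; rewrite i0 eq_sym.
  have [j0|j0] := eqVneq (j %% 3) 0.
    by apply/orP; left; rewrite setUC; apply: in_bipartite_edges; rewrite !inE ?j0.
  apply/orP; right; have [i1|i1] := eqVneq (i %% 3) 1.
    by apply: in_bipartite_edges; rewrite !inE ?i1 //; move: ij i0 j0 i1 i3 j3; clear; lia.
  rewrite setUC; apply: in_bipartite_edges; rewrite !inE;
  by move: ij i0 j0 i1 i3 j3; clear; lia.
exists (n - #|c 0|); first exact: leq_subr.
have c0n : #|c 0| <= n by rewrite (leq_trans (max_card _)) ?card_ord.
have dc : [disjoint c 1 & c 2].
  by rewrite disjoint_subset; apply/subsetP => i; rewrite !inE => /eqP->.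
have c12 : #|c 1| + #|c 2| <= n - #|c 0|.
  have -> : n - #|c 0| = #|~: c 0| by rewrite [RHS]cardsCs setCK card_ord.
  rewrite -cardsUI (_ : c 1 :&: c 2 = set0); last by apply/eqP; rewrite setI_eq0.
  rewrite cards0 addn0; apply: subset_leq_card; apply/subsetP => i; rewrite !inE.
  by case/orP=> /eqP->.
have bd := turan_number2_bounds (n - #|c 0|).
apply: leq_trans (subset_leq_card sub) _; apply: leq_trans (leq_card_setU _ _) _.
rewrite !card_bipartite_edges //; last by rewrite -setI_eq0 setICr.
rewrite [#|~: c 0|]cardsCs setCK card_ord (subKn c0n) mulnC leq_add2l.
move: bd c12; move: #|c 1| #|c 2| (n - _) (turan_number 2 _) => a b s q; rewrite -mulnn.
move=> /andP[_ bd] ab; have := leq_mul ab ab; have := (nat_AGM2 a b).1.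
by move: bd; rewrite -mulnn; clear; lia.
Qed.

Lemma subset_of_card (T : finType) (A : {set T}) m : m <= #|A| ->
  exists2 B : {set T}, B \subset A & #|B| = m.
Proof.
move=> mA; exists [set x in take m (enum A)].
  by apply/subsetP => x; rewrite inE => /mem_take; rewrite mem_enum.
rewrite cardsE (card_uniqP _) ?take_uniq ?enum_uniq // size_takel //.
by rewrite -cardE.
Qed.

Lemma two_colored_triangle_free (T : finType) (H : graph T) (X : {set T}) (col : pred T) :
  (forall a b, a \in X -> b \in X -> adj H a b -> col a != col b) ->
  triangle_free H X.
Proof.
move=> ne a b c aX bX cX ab bc; apply/negP => ac.
by move: (ne a b aX bX ab) (ne b c bX cX bc) (ne a c aX cX ac);
  case: (col a); case: (col b); case: (col c).
Qed.

Lemma set2_eq (T : finType) (a b c d : T) : [set a; b] = [set c; d] ->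
  a = c /\ b = d \/ a = d /\ b = c.
Proof.
move=> E; have : a \in [set c; d] by rewrite -E set21.
rewrite !inE => /orP[]/eqP e; [left | right]; split=> //.
  by move: E; rewrite e => /set2_inj.
by move: E; rewrite e (setUC [set c]) => /set2_inj.
Qed.

Lemma sparse_chordal_graph n m t r : r <= t -> t < n -> 1 < r ->
    m <= t * (n - t) + turan_number 2 r ->
  exists G : graph 'I_n, [/\ #|vertices G| = n, #|edges G| = m &
    forall H : graph 'I_n, subgraph H G -> chordal H ->
      #|edges H| + 3 <= 2 * n - t + r].
Proof.
move=> rt tn r1 mle.
(* [I 0 t] is A, [I t n] is B, [I 0 r./2] is C1 and [I r./2 r] is C2. *)
pose I a b := [set i : 'I_n | a <= i < b].
have cI a b : b <= n -> #|I a b| = b - a by exact: card_interval_ord.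
pose E1 := bipartite_edges (I t n) (I 0 t).
pose E2 := bipartite_edges (I 0 r./2) (I r./2 r).
have [rn r2n] : r <= n /\ r./2 <= n by lia.
have [r2 r20] : r./2 <= r /\ 0 < r./2 by lia.
have d1 : [disjoint I t n & I 0 t].
  by rewrite disjoint_subset; apply/subsetP => i; rewrite !inE; lia.
have d2 : [disjoint I 0 r./2 & I r./2 r].
  by rewrite disjoint_subset; apply/subsetP => i; rewrite !inE; lia.
have d12 : E1 :&: E2 = set0.
  apply/setP => e; rewrite !inE; apply/negP => /andP[/imsetP[[a b] /setXP[/= aI _] ->]].
  move=> /imsetP[[c d] /setXP[/= cJ dJ] /setP/(_ a)]; rewrite !inE eqxx /=.
  by case/esym/orP => /eqP e'; subst; move: aI cJ dJ; rewrite !inE; lia.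
have mE : m <= #|E1 :|: E2|.
  rewrite cardsU d12 cards0 subn0 !card_bipartite_edges // !cI; try lia.
  by rewrite !subn0 [(n - t) * t]mulnC -turan_number2.
(* Any [m] of these edges will do, as the upper bound passes to subgraphs. *)
have [E EE cE] := subset_of_card mE.
have EP e : e \in E -> exists c d : 'I_n, e = [set c; d] /\
    (d < t <= c \/ c < r./2 <= d /\ d < r).
  move/(subsetP EE); rewrite inE => /orP[]/imsetP[[c d] /setXP[/= cJ dJ] ->];
    exists c, d; split=> //; move: cJ dJ; rewrite !inE; lia.
have adjE a b : [set a; b] \in E ->
    (t <= a) != (t <= b) \/ [/\ a < r, b < r & (a < r./2) != (b < r./2)].
  by move/EP => [c [d [/set2_eq[[-> ->]|[-> ->]] [h|h]]]];
    solve [left; lia | right; split; move: h; clear; lia].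
have EV e : e \in E -> (e \subset [set: 'I_n]) && (#|e| == 2).
  move/EP => [c [d [-> h]]]; rewrite subsetT cards2 /=.
  suff -> : c != d by [].
  by apply/eqP => cd; move: h; rewrite cd; clear; lia.
exists (Graph EV); split=> //=; first by rewrite cardsT card_ord.
move=> H /andP[_ /= HE] cH.
(* The three sizes add up to [2 * n - t + r], and each forest has one edge less than vertices. *)
pose X1 := I 0 r./2 :|: I r n; pose X2 := I r./2 r :|: I t n; pose X3 := I 0 r.
pose EX (X : {set 'I_n}) := [set e in edges H | e \subset X].
have sub : edges H \subset EX X1 :|: EX X2 :|: EX X3.
  apply/subsetP => e eH; have [c [d [E' h]]] := EP e (subsetP HE e eH).
  rewrite !inE eH E' /= !subUset !sub1set !inE.
  by have := ltn_ord c; have := ltn_ord d; move: h rt; clear; lia.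
have tf1 : triangle_free H X1.
  apply: (@two_colored_triangle_free _ H X1 (fun i => t <= i)) => a b aX bX /(subsetP HE)/adjE D.
  by move: aX bX rt; rewrite !inE; case: D => [|[]]; clear; lia.
have tf2 : triangle_free H X2.
  apply: (@two_colored_triangle_free _ H X2 (fun i => t <= i)) => a b aX bX /(subsetP HE)/adjE D.
  by move: aX bX rt; rewrite !inE; case: D => [|[]]; clear; lia.
have tf3 : triangle_free H X3.
  apply: (@two_colored_triangle_free _ H X3 (fun i => i < r./2)) => a b aX bX /(subsetP HE)/adjE D.
  by move: aX bX rt; rewrite !inE; case: D => [|[]]; clear; lia.
have n0 : 0 < n := leq_ltn_trans (leq0n t) tn.
pose i0 : 'I_n := Ordinal n0.
have iin : i0 \in X1 /\ i0 \in X3 by rewrite !inE /= r20 (ltnW r1).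
have iin2 : Ordinal tn \in X2 by rewrite !inE /= leqnn tn orbT.
have ne (X : {set 'I_n}) (i : 'I_n) : i \in X -> X != set0.
  by move=> iX; apply/set0Pn; exists i.
have b1 : #|EX X1| < #|X1| := chordal_forest cH tf1 (ne _ _ iin.1).
have b2 : #|EX X2| < #|X2| := chordal_forest cH tf2 (ne _ _ iin2).
have b3 : #|EX X3| < #|X3| := chordal_forest cH tf3 (ne _ _ iin.2).
have c1 : #|X1| <= r./2 + (n - r).
  by apply: leq_trans (leq_card_setU _ _) _; rewrite !cI ?subn0.
have c2 : #|X2| <= (r - r./2) + (n - t).
  by apply: leq_trans (leq_card_setU _ _) _; rewrite !cI.
have c3 : #|X3| <= r by rewrite cI ?subn0.
have := subset_leq_card sub.
have u1 := (leq_card_setU (EX X1 :|: EX X2) (EX X3)).1.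
have u2 := (leq_card_setU (EX X1) (EX X2)).1.
move: u1 u2 b1 b2 b3 c1 c2 c3 rt (tn) r2; clear.
move: #|EX X1 :|: EX X2 :|: EX X3| #|EX X1 :|: EX X2|
  #|EX X1| #|EX X2| #|EX X3| #|X1| #|X2| #|X3| #|edges H|.
lia.
Qed.

(* With [t] near [2n/3] the pair [(t, t)] is valid, so that [g_2(n,m) <= 2n]. *)
Lemma g2_witness n m : turan_number 2 n < m <= turan_number 3 n ->
  exists t r : nat, [/\ 1 < r, r <= t, t < n, m <= t * (n - t) + turan_number 2 r &
    is_g2 n m (2 * n - t + r)%N].
Proof.
case/andP=> m2 m3; have bd := turan_number2_bounds.
(* Restricting to [t, r <= n] makes the search for a minimum finite. *)
pose P k := [exists t : 'I_n.+1, [exists r : 'I_n.+1,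
  (m <= t * (n - t) + turan_number 2 r) && (k == 2 * n - t + r)]].
have P2n : P (2 * n).
  have [t tn le] := turan_number3_le n.
  apply/existsP; exists (Ordinal (tn : t < n.+1)).
  apply/existsP; exists (Ordinal (tn : t < n.+1)) => /=.
  by rewrite (leq_trans m3 le) /=; move: tn; clear; lia.
have exP : exists k, P k by exists (2 * n).
have [k Pk kmin] := ex_minnP exP.
have k2n := kmin _ P2n.
case/existsP: Pk => t /existsP[r /andP[mtr /eqP kE]].
have tn := ltn_ord t; have rn := ltn_ord r.
(* [t (n - t)] alone stays below [m], so the term for [r] is positive and [r >= 2]. *)
have tt : t * (n - t) <= turan_number 2 n.
  have := (nat_AGM2 t (n - t)).1; rewrite subnKC //; have := bd n; clear; lia.
have mono a : a <= n -> turan_number 2 a <= turan_number 2 n.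
  by move=> an; have := bd a; have := bd n; have := leq_mul an an; rewrite !mulnn; clear; lia.
exists t, r; split.
- have : 0 < turan_number 2 r by move: mtr tt m2; clear; lia.
  by have := bd r; case: (nat_of_ord r) => [|[|]] //=; clear; lia.
- by move: kE k2n tn; clear; lia.
- rewrite ltn_neqAle -ltnS tn andbT; apply/eqP => tE.
  by have := mono r rn; move: mtr m2; rewrite tE subnn muln0; clear; lia.
- by [].
split.
  exists t, r; split; last by move: tn; clear; lia.
  by rewrite (subzn (tn : t <= n)); move: mtr; clear; lia.
move=> _ [t' [r' [mle ->]]].
(* A pair with [t' <= r'] has value at least [2 n], hence is no better. If [r' < t'], the pair lies
   in the finite search, as [t' > n] would bound the left term by [n^2 / 4]. *)
rewrite -kE; have [rt|rt] := leqP t' r'.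
  by move: rt k2n; clear; lia.
have t'n : t' <= n.
  rewrite leqNgt; apply/negP => nt.
  have := leq_mul (ltnW rt) (ltnW rt); have := bd r'; have := bd n.
  move: mle m2; rewrite -(subnKC (ltnW nt)) -!mulnn; move: (t' - n) => d.
  by clear; nia.
have := kmin (2 * n - t' + r'); have -> : P (2 * n - t' + r').
  apply/existsP; exists (Ordinal (t'n : t' < n.+1)).
  apply/existsP; exists (Ordinal (leq_trans rt (leqW t'n) : r' < n.+1)) => /=.
  rewrite eqxx andbT; move: mle; rewrite subzn //; clear; lia.
by move=> /(_ isT); move: t'n; clear; lia.
Qed.

(** * The value of f from an optimal pair *)

Lemma chordal_guarantee_g2 n m g : 0 < n -> is_g2 n m g -> turan_number 2 n < m ->
  (g <= 2 * n%:Z -> chordal_guarantee n m (g - 3))%R.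
Proof.
move=> n0 [gP gmin] m2 g2n T G Vn Em; have bd := turan_number2_bounds.
have /set0Pn[v0 v0V] : vertices G != set0 by rewrite -card_gt0 Vn.
have [v /= vV vmax] := arg_maxnP (P := fun u => u \in vertices G) (fun u => #|nbr G u|) v0V.
set D := #|nbr G v|.
have Dn : D <= n by rewrite -Vn subset_leq_card // nbr_sub.
have m4 : n ^ 2 < 4 * m by have := bd n; move: m2; clear; lia.
(* The average degree exceeds [n / 2]. *)
have n2D : n < 2 * D.
  have : 2 * m <= n * D.
    by rewrite -Em -handshake -Vn -sum_nat_const; apply: leq_sum.
  by move: m4; rewrite -mulnn => h1 h2; rewrite -(ltn_pmul2l n0); move: h1 h2; clear; lia.
(* Up to truncation at 0, [r] gives [(D, r)] the value [g - 1], so this pair cannot be valid and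
   [dense_build] yields more than [g - 4] edges. *)
pose r := absz (Num.max (g - 1 - 2 * n%:Z + D%:Z) 0)%R.
have rE : (r%:Z = Num.max (g - 1 - 2 * n%:Z + D%:Z) 0)%R by rewrite /r; clear; lia.
have rD : r <= D by move: rE g2n n2D; clear; lia.
have [le|lt] := leqP (4 * m) (4 * (D * (n - D)) + r ^ 2).
  have mr : m <= D * (n - D) + turan_number 2 r by have := bd r; move: le; clear; lia.
  have gr : (g <= 2 * n%:Z - D%:Z + r%:Z)%R.
    by apply: gmin; exists D, r; split=> //; rewrite subzn //; move: mr; clear; lia.
  (* Validity is only conceivable in the truncated case, and then [m <= D (n - D) <= n^2 / 4]. *)
  have r0 : r = 0 by move: gr rE; clear; lia.
  suff [] : False; have := (nat_AGM2 D (n - D)).1; rewrite subnKC //.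
  by move: le m4; rewrite r0; clear; lia.
have [S [F [bF cF]]] : exists S F, build G S F /\ 2 * n + r < #|F| + D + 3.
  by rewrite -Vn; apply: dense_build; rewrite ?Vn ?Em //; [move: n2D; clear; lia].
have [H [HG cH HF]] := build_chordal_subgraph bF.
exists H; split=> //; rewrite HF; move: cF rE.
by clearbody r D; clear; move: #|F|; lia.
Qed.

Local Open Scope ring_scope.
Theorem theorem1p5 (n m : nat) :
  (1 <= n)%N ->
  (turan_number 2 n + 1 <= m <= turan_number 3 n)%N ->
  exists2 g : int, is_g2 n m g & is_f n m (g - 3).
Proof.
rewrite addn1 => n0 m23; have [t [r [r1 rt tn mle g2]]] := g2_witness m23.
case/andP: m23 => m2 _.
exists (2 * n - t + r)%N => //; split.
  by apply: chordal_guarantee_g2 => //; move: rt tn; clear; lia.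
move=> w guar; have [G [Vn Em ub]] := sparse_chordal_graph rt tn r1 mle.
have [H [HG cH wH]] := guar _ G Vn Em.
by have := ub H HG cH; move: wH; clear; lia.
Qed.
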